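(* For every real $\varepsilon>0$, there exists a constant $C_0>0$ (depending only on $\varepsilon$) such that the following holds. Let $H$ be a digraph with $h\ge 1$ arcs and no isolated vertices, and let $D$ be an $n$-vertex digraph with $n\ge C_0h$ and $\delta^0(D)\ge(1/2+\varepsilon)n$. Then $D$ contains a spanning $H$-subdivision in which the lengths of any two subdivision paths differ by at most one.
   Context: All digraphs are finite and loopless; as usual, the arcs of a digraph form a set of ordered pairs of distinct vertices, so there are no parallel arcs, but both $uv$ and $vu$ may be arcs. For a digraph $D$, $V(D)$ and $A(D)$ denote its vertex set and arc set, and for $v\in V(D)$, $d_D^+(v)$ and $d_D^-(v)$ denote the numbers of out-neighbors and in-neighbors of $v$. The minimum semi-degree is $\delta^0(D)=\min\{\min_{v\in V(D)}d_D^+(v),\ \min_{v\in V(D)}d_D^-(v)\}$. A vertex is isolated if it is incident with no arc. The length of a directed path is its number of arcs. Given a digraph $H$, an $H$-subdivision is obtained by replacing each arc $uv\in A(H)$ with a directed $u$--$v$ path so that these paths (the subdivision paths) are internally vertex-disjoint and their internal vertices avoid the vertices corresponding to $V(H)$ (the branch vertices). Thus an $H$-subdivision in $D$ consists of distinct branch vertices $b_v\in V(D)$, one for each $v\in V(H)$, and, for each arc $uv\in A(H)$, a directed path in $D$ from $b_u$ to $b_v$ of length at least one, such that no internal vertex of any of these paths is a branch vertex and no vertex is an internal vertex of two different paths. An $H$-subdivision in $D$ is spanning if it contains every vertex of $D$, i.e. every vertex of $D$ is a branch vertex or an internal vertex of some subdivision path. *)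

(* Defs.v *)
From mathcomp Require Import all_boot all_order all_algebra.
From mathcomp Require Import reals.

Set Implicit Arguments.
Unset Strict Implicit.
Unset Printing Implicit Defensive.

Record digraph := Digraph {
  vertex :> finType;
  arc : rel vertex;
  arc_irr : irreflexive arc
}.

Definition arcs (D : digraph) : {set D * D} := [set e | arc e.1 e.2].

Definition outdeg (D : digraph) (v : D) : nat := #|[set w : D | arc v w]|.

Definition indeg (D : digraph) (v : D) : nat := #|[set w : D | arc w v]|.

(* The default value #|D| of the minima exceeds every degree, so it is only
   reached by the digraph without vertices. *)
Definition min_semidegree (D : digraph) : nat :=
  minn (\big[minn/#|D|]_(v : D) outdeg v) (\big[minn/#|D|]_(v : D) indeg v).

Definition isolated (D : digraph) (v : D) : bool :=
  [forall w : D, ~~ arc v w && ~~ arc w v].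

(* A directed path of length at least one from x to y, given by the sequence p
   of its internal vertices. *)
Definition dipath (D : digraph) (x : D) (p : seq D) (y : D) : bool :=
  path (@arc D) x (rcons p y) && uniq (x :: rcons p y).

(* The values of inner on pairs that are not arcs of H are irrelevant. *)
Record subdivision (H D : digraph) := Subdivision {
  branch : H -> D;
  inner : H -> H -> seq D;
  branch_inj : injective branch;
  inner_path : forall u v : H, arc u v ->
    dipath (branch u) (inner u v) (branch v);
  inner_not_branch : forall u v w : H, arc u v -> branch w \notin inner u v;
  inner_disjoint : forall u v u' v' : H, arc u v -> arc u' v' ->
    (u, v) <> (u', v') ->
    forall x : D, x \in inner u v -> x \notin inner u' v'
}.

Definition path_length (H D : digraph) (S : subdivision H D) (u v : H) : nat :=
  (size (inner S u v)).+1.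

Definition spanning (H D : digraph) (S : subdivision H D) : Prop :=
  forall x : D, (exists w : H, x = branch S w) \/
    (exists u v : H, arc u v /\ x \in inner S u v).

Definition balanced (H D : digraph) (S : subdivision H D) : Prop :=
  forall u v u' v' : H, arc u v -> arc u' v' ->
    path_length S u v <= (path_length S u' v').+1.

(* Main.v *)
Require Import Defs.
From mathcomp Require Import all_boot all_order all_algebra.
From mathcomp Require Import reals.
From mathcomp Require Import zify ring lra.
(* [arc] is the relation of a digraph, not the arc of a cyclic sequence. *)
Import Defs.
Import Order.TTheory GRing.Theory Num.Theory.

(** The branch vertices are chosen arbitrarily; the semi-degree condition then
    survives in the set [U] of remaining vertices, because there are at most
    [2h] branch vertices.  It remains to cut [U] into one block [B a] for each
    arc [a = (u, v)] of [H], with sizes that differ by at most one, and to thread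
    a directed path from the branch vertex of [u] to that of [v] through all
    of [B a].

    Such a path exists as soon as every vertex of [B a], the start as a source
    and the end as a target have more than half of [B a] as out- and
    in-neighbours: identify the start and the end, and apply the theorem of
    Ghouila-Houri ([ghouila_houri], [hamilton_path]).  As the degrees exceed one
    half by a fixed proportion, this is robust, and the whole difficulty is to
    find a partition in which _every_ block inherits the degree condition, even
    though the blocks may have bounded size and be linear in number.  A single
    random partition would produce some bad blocks.

    The partition is therefore obtained by repeated halving
    ([balanced_partition]).  To divide [U], with [n] elements, between two halves
    of the list of arcs, only [O(n)] neighbourhoods matter: those of the vertices
    of [U] and those of the ends of the paths routed through [U].  A fourth-moment
    argument, derandomised by always choosing the better of the two sides
    ([discrepancy_seq]), gives a subset of [U] that splits each of these
    neighbourhoods in the right proportion up to an error [O(n^(3/4))].  Relative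
    to [n], the error is [O(n^(-1/4))], and along the halvings these errors form a
    geometric sum dominated by its last term, which is small as soon as the final
    blocks are large.  The lower bound [threshold] is chosen to absorb them: each
    halving turns the bound for [n] into the bound for the smaller size
    ([threshold_split]). *)

Set Implicit Arguments.
Unset Strict Implicit.
Unset Printing Implicit Defensive.

(** * Hamilton cycles and paths in digraphs of large semi-degree *)

Section GhouilaHouri.
Variables (T : finType) (e : rel T).

Lemma uniq_size_le_card (W : {set T}) (s : seq T) :
  uniq s -> {subset s <= W} -> size s <= #|W|.
Proof.
by move=> /card_uniqP <- sub; apply/subset_leq_card/subsetP.
Qed.

(** Maximality is stated at both ends: this is what forces the neighbours of the
    ends of the path to lie on it. *)
Lemma maximal_path (W : {set T}) x0 : x0 \in W ->
  exists (a : T) (p : seq T), [/\ path e a p, uniq (a :: p), {subset a :: p <= W},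
    (forall z, z \in W -> e z a -> z \in a :: p) &
    (forall z, z \in W -> e (last a p) z -> z \in a :: p)].
Proof.
move=> x0W; set maximal := ex _.
suff main k (a : T) (p : seq T) : #|W| < size (a :: p) + k -> path e a p ->
    uniq (a :: p) -> {subset a :: p <= W} -> maximal.
  by apply: (main #|W| x0 [::]) => // z; rewrite inE => /eqP->.
elim: k a p => [|k IH] a p szW path_p uniq_p subW.
  by have := uniq_size_le_card uniq_p subW; lia.
case: (boolP [exists z in W, e z a && (z \notin a :: p)]).
  case/existsP=> z /and3P[zW eza zp]; apply: (IH z (a :: p)) => /=.
  - by move: szW => /=; lia.
  - by rewrite eza.
  - by rewrite zp.
  - by move=> y; rewrite inE => /predU1P[->|/subW].
rewrite negb_exists => /forallP no_pred.
case: (boolP [exists z in W, e (last a p) z && (z \notin a :: p)]).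
  case/existsP=> z /and3P[zW ez zp]; apply: (IH a (rcons p z)).
  - by move: szW => /=; rewrite size_rcons; lia.
  - by rewrite rcons_path path_p.
  - by rewrite -rcons_cons rcons_uniq zp.
  - by move=> y; rewrite -rcons_cons mem_rcons inE => /predU1P[->|/subW].
rewrite negb_exists => /forallP no_succ.
exists a, p; split=> // z zW ez.
  by have := no_pred z; rewrite zW ez /= negbK.
by have := no_succ z; rewrite zW ez /= negbK.
Qed.

Lemma last_occurrence (A : pred T) (s : seq T) : has A s ->
  exists (s1 : seq T) (x : T) (s2 : seq T),
    [/\ s = s1 ++ x :: s2, A x & ~~ has A s2].
Proof.
elim: s => //= y s IH.
have [/IH[s1 [x [s2 [-> Ax nA]]]] _|nA /orP[Ay|//]] := boolP (has A s).
  by exists (y :: s1), x, s2.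
by exists [::], y, s.
Qed.

Lemma first_occurrence (B : pred T) (s : seq T) : has B s ->
  exists (s1 : seq T) (y : T) (s2 : seq T),
    [/\ s = s1 ++ y :: s2, B y & ~~ has B s1].
Proof.
elim: s => //= y s IH.
have [By _|nB /= /IH[s1 [x [s2 [-> Bx nB1]]]]] := boolP (B y).
  by exists [::], y, s.
by exists (y :: s1), x, s2; rewrite /= (negbTE nB).
Qed.

(** Going round a cycle that meets [A] and [B], some passage from an element of
    [A] to an element of [B] meets neither set in between: take the first element
    of [B] after some element of [A], then the last element of [A] before it.  The
    default value of [head] covers the passage that goes all the way round and
    returns to [x]. *)
Lemma cyclic_gap (A B : pred T) (s : seq T) : has A s -> has B s ->
  exists i (x : T) (m r : seq T), [/\ rot i s = x :: m ++ r, A x, B (head x r),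
    ~~ has A m & ~~ has B m].
Proof.
move=> hasA hasB.
case/hasP: (hasA) => x0 x0s Ax0; have [i0 s' def_s] := rot_to x0s.
have hasB' : has B (x0 :: s') by rewrite -def_s has_rot.
suff [i [x [m [r [def_r Ax Br nA nB]]]]] : exists i (x : T) (m r : seq T),
    [/\ rot i (rot i0 s) = x :: m ++ r, A x, B (head x r),
     ~~ has A m & ~~ has B m].
  move: def_r; rewrite rot_rot_add => def_r.
  by eexists; exists x, m, r; split; eauto.
rewrite def_s; case: (boolP (has B s')) => [Bs'|nBs'].
  have [l1 [y [l2 [-> By nB1]]]] := first_occurrence Bs'.
  have [|m1 [x [m2 [eq_l Ax nA2]]]] := @last_occurrence A (x0 :: l1).
    by rewrite /= Ax0.
  exists (size m1), x, m2, (y :: l2 ++ m1).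
  rewrite -(cat_cons x0) eq_l -catA rot_size_cat /= -?catA; split=> //.
  apply: contra nB1; case: m1 eq_l => [|z m1] /= [_ ->] //.
  by rewrite has_cat /= => ->; rewrite !orbT.
have [|m1 [x [m2 [eq_l Ax nA2]]]] := @last_occurrence A (x0 :: s').
  by rewrite /= Ax0.
exists (size m1), x, m2, m1; rewrite eq_l rot_size_cat /=; split=> //.
  case: m1 eq_l => [|z m1] /= [eq_x _].
    by move: hasB'; rewrite /= (negbTE nBs') orbF eq_x.
  by move: hasB'; rewrite /= (negbTE nBs') orbF eq_x.
apply: contra nBs'; case: m1 eq_l => [|z m1] /= [_ ->] //.
by rewrite has_cat /= => ->; rewrite !orbT.
Qed.

(** The exchange step: the arc of the cycle between [x] and [head x r] is replaced
    by a path outside the cycle. *)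
Lemma cycle_reroute (s : seq T) i (x : T) (m r : seq T) (a : T) (p : seq T) :
  ucycle e s -> rot i s = x :: m ++ r -> path e a p -> uniq (a :: p) ->
  [disjoint a :: p & s] -> e x a -> e (last a p) (head x r) ->
  ucycle e (x :: a :: p ++ r).
Proof.
move=> /andP[cyc_s uniq_s] def_r path_p uniq_p dis exa epr.
have mem_s z : z \in x :: m ++ r -> z \in s by rewrite -def_r mem_rot.
move: cyc_s uniq_s; rewrite -(rot_cycle i) -(rot_uniq i) def_r.
rewrite /ucycle -[a :: p ++ r]/((a :: p) ++ r).
rewrite [cycle _ _]/= [uniq _]/= rcons_cat cat_path => /andP[path_m path_r].
rewrite mem_cat negb_or cat_uniq => /and3P[/andP[xm xr] um /andP[mr ur]].
apply/andP; split.
  rewrite /= rcons_cat cat_path exa path_p /=.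
  case: r path_r epr {xr mr ur mem_s def_r} => [|y r] /=; rewrite ?andbT //.
  by move=> /andP[_ ->] ->.
have disS z : z \in a :: p -> z \notin x :: m ++ r.
  by move=> zp; apply: contraL zp => /mem_s zs; rewrite (disjointFl dis zs).
have xp : x \notin a :: p by apply/negP => /disS; rewrite inE eqxx.
change (uniq ((x :: a :: p) ++ r)); rewrite cat_uniq ur andbT.
apply/andP; split; first by rewrite cons_uniq xp.
apply/hasPn => z zr; rewrite inE negb_or; apply/andP; split.
  by apply: contraNneq xr => <-.
by apply/negP => /disS; rewrite inE mem_cat zr !orbT.
Qed.

Lemma count_no_adjacent (A B : pred T) (x : T) (s : seq T) :
  path [rel u v | ~~ (A u && B v)] x s ->
  count A (belast x s) + count B s <= size s.
Proof.
elim: s x => //= y s IH x /andP[nAB /IH]; move: nAB.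
by case: (A x); case: (B y) => //=; lia.
Qed.

(** Let [a :: p] be a maximal path off the cycle, of order [l].  If no passage
    from an in-neighbour of [a] to an out-neighbour of the last vertex [b] of the
    path can be replaced by the path, then each such passage skips at least [l]
    vertices.  So a successor of an in-neighbour of [a] is never an out-neighbour
    of [b], and one gap contains [l - 1] further vertices that are neither; hence
    the cycle has at least [|A| + |B| + l - 1] vertices, where [A] and [B] are the
    sets of these neighbours on the cycle.  By maximality each of them has at least
    [|W|/2 - (l - 1)] elements, so this exceeds the [|W| - l] vertices
    available. *)
Lemma longer_cycle (W : {set T}) (s : seq T) :
  (forall v, v \in W -> ~~ e v v) ->
  (forall v, v \in W -> #|W| <= 2 * #|[set u in W | e v u]|) ->
  (forall v, v \in W -> #|W| <= 2 * #|[set u in W | e u v]|) ->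
  ucycle e s -> {subset s <= W} -> #|W| < 2 * size s -> size s < #|W| ->
  exists s' : seq T, [/\ ucycle e s', {subset s' <= W} & size s < size s'].
Proof.
move=> irr degO degI cyc_s sW s_big s_small.
have us := ucycle_uniq cyc_s.
pose R := W :\: [set z in s].
have cardR : #|R| = #|W| - size s.
  rewrite cardsD (_ : W :&: _ = [set z in s]).
    by rewrite cardsE (card_uniqP us).
  by apply/setIidPr/subsetP => z; rewrite inE => /sW.
have [x0 x0R] : exists x0, x0 \in R by apply/card_gt0P; rewrite cardR subn_gt0.
have [a [p [path_p uniq_p pR predR succR]]] := maximal_path x0R.
pose b := last a p.
have pW z : z \in a :: p -> z \in W by move/pR; rewrite inE => /andP[].
have dis : [disjoint a :: p & s].
  apply/pred0Pn => -[z /andP[/= /pR]]; rewrite inE => /andP[+ _] zs.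
  by rewrite inE zs.
have bp : b \in a :: p := mem_last a p.
have szp := uniq_size_le_card uniq_p pR.
pose A : pred T := fun z => e z a; pose B : pred T := fun z => e b z.
(* All neighbours of an end [c] of the path that are off the cycle lie on the
   path, and differ from [c]. *)
have bound (C : pred T) c : c \in a :: p -> ~~ C c ->
    (forall z, z \in R -> C z -> z \in a :: p) ->
    #|[set u in W | C u]| <= count C s + (size p).
  move=> cp nCc CR.
  have sub : [set u in W | C u] \subset
      [set z in filter C s] :|: ([set z in a :: p] :\ c).
    apply/subsetP => z; rewrite !inE mem_filter => /andP[zW Cz]; rewrite Cz /=.
    case: (boolP (z \in s)) => //= zs; rewrite -in_cons; apply/andP; split.
      by apply: contraNneq nCc => <-.
    by apply: CR => //; rewrite !inE zs.
  apply: (leq_trans (subset_leq_card sub)).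
  apply: (leq_trans (leq_card_setU _ _)); rewrite leq_add //.
    by rewrite cardsE -size_filter card_size.
  rewrite -ltnS (leq_trans _ (card_size (a :: p))) //.
  have -> : #|a :: p| = #|[set z in a :: p]| by rewrite cardsE.
  by rewrite [X in _ < X](cardsD1 c) inE cp.
have cntA : #|W| <= 2 * (count A s + size p).
  apply: (leq_trans (degI a (pW _ (mem_head a p)))); rewrite leq_mul2l /=.
  by apply: (bound A a) => //; [exact: mem_head | exact: irr (pW _ (mem_head a p))].
have cntB : #|W| <= 2 * (count B s + size p).
  apply: (leq_trans (degO b (pW _ bp))); rewrite leq_mul2l /=.
  by apply: (bound B b) => //; exact: irr (pW _ bp).
have {szp} szp : size p < #|W| - size s by move: szp; rewrite cardR.
(* The cycle contains more than half of [W], so the path has fewer than [|W| / 2]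
   vertices, and both its ends have neighbours on the cycle. *)
have hasA : has A s by rewrite has_count; lia.
have hasB : has B s by rewrite has_count; lia.
have reroute i (x : T) (m r : seq T) : rot i s = x :: m ++ r -> A x -> B (head x r) ->
    size m <= size p ->
  exists s' : seq T, [/\ ucycle e s', {subset s' <= W} & size s < size s'].
  move=> def_r Ax Br le_mp; exists (x :: a :: p ++ r); split.
  - exact: (cycle_reroute cyc_s def_r).
  - move=> z; rewrite inE -[a :: _]/((a :: p) ++ r) mem_cat => /or3P[zx|/pW//|zr].
      by apply: sW; rewrite -(mem_rot i) def_r inE zx.
    by apply: sW; rewrite -(mem_rot i) def_r inE mem_cat zr !orbT.
  - by rewrite -(size_rot i s) def_r /= !size_cat !ltnS leq_add2r.
have [i [x [m [r [def_r Ax Br nA nB]]]]] := cyclic_gap hasA hasB.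
have [|gt_mp] := leqP (size m) (size p); first exact: (reroute _ _ _ _ def_r Ax Br).
(* If no vertex of [A] is followed by one of [B], count along the cycle;
   otherwise the path can be inserted without removing any vertex. *)
case: (boolP (cycle [rel u v | ~~ (A u && B v)] s)) => [cycAB|].
  move: cycAB; rewrite -(rot_cycle i) def_r /= rcons_cat cat_path => /andP[_ pathr].
  have szs : size s = (size m + size r).+1 by rewrite -(size_rot i s) def_r /= size_cat.
  have /seq.permP perm_r : perm_eq (x :: m ++ r) s by rewrite -def_r perm_rot.
  have := perm_r A; have := perm_r B; rewrite /= !count_cat.
  move: nA nB; rewrite !has_count -!eqn0Ngt => /eqP-> /eqP->.
  case: r pathr {def_r Br perm_r} szs => [|y r] /=.
    have := leq_b1 (A x); have := leq_b1 (B x); move: szp gt_mp cntA cntB.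
    by move: (nat_of_bool (A x)) (nat_of_bool (B x)) => *; lia.
  move=> /andP[_ /count_no_adjacent]; rewrite belast_rcons -cats1 count_cat size_cat /=.
  have := leq_b1 (A x); have := leq_b1 (B y); move: szp gt_mp cntA cntB.
  move: (nat_of_bool (A x)) (nat_of_bool (B x)) (nat_of_bool (A y)) (nat_of_bool (B y)) => *.
  by lia.
move=> nAB; have [u us' nxt] : exists2 u, u \in s & A u && B (next s u).
  apply/hasP; apply: contraR nAB => /hasPn nAB.
  by apply: cycle_from_next => // u /nAB.
have [j s2 def_j] := rot_to us'.
case/andP: nxt => Au; rewrite -(next_rot j) // def_j => Bu.
apply: (reroute j u [::] s2 def_j Au) => //.
by case: s2 Bu {def_j} => [|y s2] /=; rewrite eqxx.
Qed.

(** The last vertex of a maximal path has all its out-neighbours on the path; the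
    cycle closed at the first of them contains them all, and the last vertex
    too. *)
Lemma initial_cycle (W : {set T}) :
  (forall v, v \in W -> ~~ e v v) ->
  (forall v, v \in W -> #|W| <= 2 * #|[set u in W | e v u]|) ->
  0 < #|W| ->
  exists s : seq T, [/\ ucycle e s, {subset s <= W} & #|W| < 2 * size s].
Proof.
move=> irr degO /card_gt0P[x0 x0W].
have [a [p [path_p uniq_p pW _ succW]]] := maximal_path x0W.
set b := last a p in succW.
have bp : b \in a :: p := mem_last a p.
have bW : b \in W := pW _ bp.
have [|s1 [c [s2 [def_p bc nb]]]] := @first_occurrence (e b) (a :: p).
  have : 0 < #|[set u in W | e b u]|.
    have : 0 < #|W| by apply/card_gt0P; exists b.
    by have := degO _ bW; lia.
  case/card_gt0P=> z; rewrite inE => /andP[zW bz].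
  by apply/hasP; exists z; rewrite ?succW.
have path_c : path e c s2 /\ last c s2 = b.
  case: s1 def_p {nb} => [|a' s1] /= [eq_a def_p]; first by rewrite /b -eq_a -def_p.
  by move: path_p; rewrite /b def_p cat_path last_cat /= => /and3P[].
have uniq_c : uniq (c :: s2) by move: uniq_p; rewrite def_p cat_uniq => /and3P[].
exists (c :: s2); split.
- by rewrite /ucycle uniq_c /= rcons_path path_c.1 path_c.2 bc.
- by move=> z zc; apply: pW; rewrite def_p mem_cat zc orbT.
- apply: (leq_ltn_trans (degO b bW)); rewrite ltn_pmul2l //.
  rewrite -(card_uniqP uniq_c) proper_card //; apply/properP; split.
    apply/subsetP => z; rewrite inE => /andP[zW bz].
    have := succW z zW bz; rewrite def_p mem_cat => /orP[z1|//].
    by case/negP: nb; apply/hasP; exists z.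
  exists b; first by rewrite -path_c.2 mem_last.
  by rewrite inE negb_and irr ?orbT.
Qed.

Theorem ghouila_houri (W : {set T}) :
  (forall v, v \in W -> ~~ e v v) ->
  (forall v, v \in W -> #|W| <= 2 * #|[set u in W | e v u]|) ->
  (forall v, v \in W -> #|W| <= 2 * #|[set u in W | e u v]|) ->
  0 < #|W| ->
  exists s : seq T, ucycle e s /\ s =i W.
Proof.
move=> irr degO degI W0.
have [s [cyc_s sW s_big]] := initial_cycle irr degO W0.
have [k] := ubnP (#|W| - size s).
elim: k s cyc_s sW s_big => // k IH s cyc_s sW s_big ltk.
have us := ucycle_uniq cyc_s.
have := uniq_size_le_card us sW; rewrite leq_eqVlt => /orP[/eqP eq_s|lt_s].
  exists s; split=> // z; rewrite -(mem_enum W).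
  apply: (uniq_min_size us _ _).2; last by rewrite -cardE eq_s.
  by move=> u /sW; rewrite mem_enum.
have [s' [cyc_s' s'W s'_big]] := longer_cycle irr degO degI cyc_s sW s_big lt_s.
by apply: (IH s') => //; lia.
Qed.
End GhouilaHouri.

(** Merge [x] and [y] into one vertex, represented by [x], which keeps the
    out-neighbours of [x] and receives the in-neighbours of [y]: a Hamilton cycle
    of the merged digraph, opened at this vertex, is the required path. *)
Theorem hamilton_path (T : finType) (e : rel T) (U : {set T}) (x y : T) :
  irreflexive e -> x \notin U -> y \notin U -> x != y ->
  (forall v, v \in x |: U -> #|U| < 2 * #|[set u in U | e v u]|) ->
  (forall v, v \in y |: U -> #|U| < 2 * #|[set u in U | e u v]|) ->
  exists p : seq T,
    [/\ path e x (rcons p y), uniq (x :: rcons p y), p =i U & size p = #|U|].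
Proof.
move=> irr xU yU xy degO degI.
pose W := x |: U.
pose e' : rel T := fun u v => if v == x then (u != x) && e u y else e u v.
have cardW : #|W| = #|U|.+1 by rewrite cardsU1 xU.
have nx z : z \in U -> z == x = false by move=> zU; apply: contraNF xU => /eqP<-.
have [|v vW|v vW||s [/andP[cyc_s uniq_s] sW]] := @ghouila_houri T e' W.
- by move=> v _; rewrite /e'; case: eqVneq => //= _; rewrite irr.
- rewrite cardW; apply: leq_trans (degO v vW) _; rewrite leq_mul2l /=.
  apply/subset_leq_card/subsetP => z; rewrite !inE => /andP[zU evz].
  by rewrite zU orbT /e' nx.
- rewrite cardW.
  have [->|vx] := eqVneq v x.
    apply: leq_trans (degI y (setU11 _ _)) _; rewrite leq_mul2l /=.
    apply/subset_leq_card/subsetP => z; rewrite !inE => /andP[zU evz].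
    by rewrite zU orbT /e' eqxx nx.
  have vU : v \in U by move: vW; rewrite !inE (negbTE vx).
  apply: leq_trans (degI v _) _; first by rewrite inE vU orbT.
  rewrite leq_mul2l /=.
  apply/subset_leq_card/subsetP => z; rewrite !inE => /andP[zU evz].
  by rewrite zU orbT /e' (negbTE vx).
- by rewrite cardW.
have xs : x \in s by rewrite sW setU11.
have [i p def_s] := rot_to xs.
move: cyc_s uniq_s; rewrite -(rot_cycle i) -(rot_uniq i) def_s /=.
move=> path_p /andP[xp up].
have pU : p =i U.
  move=> z; have := sW z; rewrite -(mem_rot i) def_s !inE.
  by have [->|//] := eqVneq z x; rewrite (negbTE xp) (negbTE xU).
have szp : size p = #|U| by rewrite -(card_uniqP up); apply: eq_card.
exists p; split=> //; last first.
  by rewrite mem_rcons inE (negbTE xy) (negbTE xp) rcons_uniq pU yU.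
have p_nil : p != [::].
  rewrite -size_eq0 szp; apply/eqP => U0.
  have := degO x (setU11 _ _).
  have := subset_leq_card (subsetIl U [set u | e x u]).
  by rewrite -setIdE U0; lia.
move: path_p; rewrite !rcons_path => /andP[path_p]; rewrite {1}/e' eqxx => /andP[_ ->].
rewrite andbT; suff sub q u : x \notin q -> path e' u q -> path e u q by exact: sub.
elim: q u => //= v q IH u.
rewrite inE negb_or => /andP[xv xq] /andP[euv /(IH _ xq) ->].
by move: euv; rewrite /e' eq_sym (negbTE xv) => ->.
Qed.

(** * Splitting a set in proportion to many given sets *)

Local Open Scope ring_scope.

(** With [k] elements still to be distributed at random and a discrepancy [S], this
    bounds the expected fourth power of the final discrepancy. *)
Definition potential (R : realFieldType) (k : nat) (S : R) : R :=
  S ^+ 4 + 8 * k%:R * S ^+ 2 + 4 * k%:R ^+ 2.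

(** An element of the set under consideration goes to the subset with
    probability [rho] and then changes the discrepancy by [1 - rho], otherwise by
    [- rho]; [t] tells whether the element belongs to the set.  As the mean change
    is zero, there is no term in [S ^+ 3], and the terms in [S ^+ 2] and [S] are
    paid for by the decrease of [k]. *)
Lemma potential_step (R : realFieldType) (rho S : R) (k : nat) (t : bool) :
  0 <= rho <= 1 ->
  rho * potential k (S + (1 - rho) * t%:R) +
    (1 - rho) * potential k (S + (0 - rho) * t%:R)
  <= potential k.+1 S.
Proof.
move=> /andP[r0 r1]; rewrite /potential -[k.+1%:R]natr1.
have : 0 <= k%:R :> R by rewrite ler0n.
move: (k%:R : R) => m m0.
have S2 : 0 <= S ^+ 2 by apply: sqr_ge0.
case: t; last first.
  rewrite !mulr0 !addr0 -subr_ge0.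
  have -> : S ^+ 4 + 8 * (m + 1) * S ^+ 2 + 4 * (m + 1) ^+ 2 -
    (rho * (S ^+ 4 + 8 * m * S ^+ 2 + 4 * m ^+ 2) +
      (1 - rho) * (S ^+ 4 + 8 * m * S ^+ 2 + 4 * m ^+ 2))
    = 8 * S ^+ 2 + 8 * m + 4 by ring.
  by lra.
rewrite !mulr1.
(* The moments of the change are [0], [v], [v * w] and [v * (1 - 3 * v)]. *)
pose v := rho * (1 - rho); pose w := 1 - 2 * rho.
have v0 : 0 <= v by rewrite /v; nra.
have v1 : v <= 1 by rewrite /v; nra.
have -> : rho * ((S + (1 - rho)) ^+ 4 + 8 * m * (S + (1 - rho)) ^+ 2 + 4 * m ^+ 2) +
   (1 - rho) * ((S + (0 - rho)) ^+ 4 + 8 * m * (S + (0 - rho)) ^+ 2 + 4 * m ^+ 2)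
  = S ^+ 4 + 6 * S ^+ 2 * v + 4 * S * (v * w) + v * (1 - 3 * v) +
    8 * m * (S ^+ 2 + v) + 4 * m ^+ 2.
  by rewrite /v /w; ring.
have vw : -1 <= v * w <= 1 by rewrite /w; apply/andP; split; nra.
have Svw : 4 * S * (v * w) <= 2 * S ^+ 2 + 2.
  move: (v * w) vw => u /andP[u1 u2].
  have : 0 <= (S - u) ^+ 2 by apply: sqr_ge0.
  have : u ^+ 2 <= 1 by nra.
  by nra.
have mv : m * v <= m by nra.
have vv : v * (1 - 3 * v) <= 1 by nra.
have Sv : S ^+ 2 * v <= S ^+ 2 by nra.
rewrite -subr_ge0.
have -> : S ^+ 4 + 8 * (m + 1) * S ^+ 2 + 4 * (m + 1) ^+ 2 -
  (S ^+ 4 + 6 * S ^+ 2 * v + 4 * S * (v * w) + v * (1 - 3 * v) +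
    8 * m * (S ^+ 2 + v) + 4 * m ^+ 2)
  = 6 * (S ^+ 2 - S ^+ 2 * v) + (2 * S ^+ 2 + 2 - 4 * S * (v * w)) +
    (1 - v * (1 - 3 * v)) +
    8 * (m - m * v) + 1 by ring.
by lra.
Qed.

(** The weighted mean of the total potentials of the two choices for the next
    element is at most the present total, so one of the choices does not
    increase it. *)
Lemma discrepancy_seq (R : realFieldType) (T : finType) (rho : R) (As : seq {set T}) :
  0 <= rho <= 1 -> forall (s : seq T) (S : {set T} -> R), uniq s ->
  exists B : {set T},
    \sum_(A <- As) (S A + \sum_(x <- s) ((x \in B)%:R - rho) * (x \in A)%:R) ^+ 4
    <= \sum_(A <- As) potential (size s) (S A).
Proof.
move=> rho01; elim=> [|x s IH] S /=.
  exists set0; apply/ler_sum => A _; rewrite big_nil /potential.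
  by rewrite addr0 mulr0 mul0r expr0n /= mulr0 !addr0.
case/andP=> xs us; have /andP[r0 r1] := rho01.
pose S1 A := S A + (1 - rho) * (x \in A)%:R.
pose S0 A := S A + (0 - rho) * (x \in A)%:R.
have avg : rho * (\sum_(A <- As) potential (size s) (S1 A)) +
   (1 - rho) * (\sum_(A <- As) potential (size s) (S0 A)) <=
    \sum_(A <- As) potential (size s).+1 (S A).
  rewrite !mulr_sumr -big_split /=; apply: ler_sum => A _.
  exact: potential_step.
have extend (b : bool) :
    \sum_(A <- As) potential (size s) (S A + (b%:R - rho) * (x \in A)%:R) <=
      \sum_(A <- As) potential (size s).+1 (S A) ->
  exists B : {set T},
    \sum_(A <- As) (S A + \sum_(y <- x :: s) ((y \in B)%:R - rho) * (y \in A)%:R) ^+ 4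
    <= \sum_(A <- As) potential (size s).+1 (S A).
  have [B HB] := IH (fun A => S A + (b%:R - rho) * (x \in A)%:R) us.
  move=> le_S; exists [set y | if y == x then b else y \in B].
  apply: le_trans (le_trans HB le_S); apply: ler_sum => A _.
  rewrite big_cons inE eqxx addrA.
  rewrite (eq_big_seq (fun y => ((y \in B)%:R - rho) * (y \in A)%:R)) //.
  by move=> y ys; rewrite inE; case: eqVneq ys xs => // -> ->.
have [le1|gt1] := lerP (\sum_(A <- As) potential (size s) (S1 A))
  (\sum_(A <- As) potential (size s).+1 (S A)).
  exact: (extend true).
apply: (extend false).
move: gt1 avg; rewrite -/(S0 _).
set P1 := \sum_(A <- As) _ (S1 A); set P0 := \sum_(A <- As) potential (size s) (S0 A).
set P := \sum_(A <- As) _ (S A) => gt1 avg.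
rewrite -[X in X <= _]/P0.
have [//|gt0] := lerP P0 P.
exfalso; move: r0; rewrite le_eqVlt => /orP[/eqP r0|r0].
  by rewrite -r0 in avg; lra.
by nra.
Qed.

Lemma proportional_subset (R : realFieldType) (T : finType) (rho : R)
    (As : seq {set T}) (U : {set T}) :
  0 <= rho <= 1 -> exists2 B : {set T}, B \subset U &
    forall A, A \in As ->
     (#|A :&: B|%:R - rho * #|A :&: U|%:R) ^+ 4 <= 4 * (size As)%:R * #|U|%:R ^+ 2.
Proof.
move=> rho01.
have [B HB] := discrepancy_seq As rho01 (fun=> 0) (enum_uniq (mem U)).
exists (B :&: U) => [|A AAs]; first exact: subsetIr.
have -> : #|A :&: (B :&: U)|%:R - rho * #|A :&: U|%:R =
    0 + \sum_(x <- enum U) ((x \in B)%:R - rho) * (x \in A)%:R.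
  rewrite add0r big_enum /=.
  under eq_bigr => x _ do rewrite mulrBl.
  rewrite sumrB -mulr_sumr; congr (_ - _ * _).
    rewrite -sum1_card natr_sum [LHS]big_mkcond [RHS]big_mkcond /=; apply: eq_bigr => x _.
    rewrite !inE; case: (x \in A); case: (x \in B); case: (x \in U);
      by rewrite /= ?mulr0 ?mulr1.
  rewrite -sum1_card natr_sum [LHS]big_mkcond [RHS]big_mkcond /=; apply: eq_bigr => x _.
  by rewrite !inE; case: (x \in A); case: (x \in U).
apply: le_trans (le_trans _ HB) _.
  rewrite (big_rem A) //= lerDl; apply: sumr_ge0 => C _.
  by rewrite -[4%N]/(2 * 2)%N exprM sqr_ge0.
rewrite -cardE (eq_bigr (fun=> 4 * #|U|%:R ^+ 2)).
  rewrite big_const_seq count_predT iter_addr addr0 le_eqVlt.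
  by rewrite -[X in X == _]mulr_natr mulrAC eqxx.
by move=> C _; rewrite /potential !expr0n /= mulr0 !add0r.
Qed.

(** Correcting the size of a set changes its traces by no more than the
    correction. *)
Lemma resize_set (T : finType) (U B : {set T}) (n1 : nat) :
  B \subset U -> (n1 <= #|U|)%N ->
  exists B' : {set T}, [/\ B' \subset U, #|B'| = n1 &
    forall A : {set T}, (#|A :&: B'| <= #|A :&: B| + (n1 - #|B|))%N /\
      (#|A :&: B| <= #|A :&: B'| + (#|B| - n1))%N].
Proof.
move=> BU n1U.
have pick (C : {set T}) k : (k <= #|C|)%N ->
    exists2 C' : {set T}, C' \subset C & #|C'| = k.
  move=> kC; exists [set x in take k (enum C)].
    by apply/subsetP => x; rewrite inE => /mem_take; rewrite mem_enum.
  by rewrite cardsE (card_uniqP (take_uniq _ (enum_uniq _))) size_takel // -cardE.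
have [le_n1|lt_n1] := leqP n1 #|B|.
  have [B' B'B cB'] := pick _ _ le_n1; exists B'; split=> // [|A].
    exact: subset_trans BU.
  split; first by rewrite (leq_trans (subset_leq_card (setIS A B'B))) // leq_addr.
  have -> : (#|B| - n1 = #|B :\: B'|)%N by rewrite -cB' cardsD (setIidPr B'B).
  rewrite -{1}(setID B B') (setIidPr B'B) setIUr.
  apply: leq_trans (leq_card_setU _ _) _.
  by rewrite leq_add2l subset_leq_card ?subsetIr.
have [|C CU cC] := pick (U :\: B) (n1 - #|B|)%N.
  by rewrite cardsD (setIidPr BU) leq_sub2r.
have dis : B :&: C = set0.
  by apply/eqP; rewrite setI_eq0 disjoint_sym; move: CU; rewrite subsetD => /andP[].
exists (B :|: C); split=> [||A].
- by rewrite subUset BU (subset_trans CU (subsetDl _ _)).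
- by rewrite cardsU dis cards0 subn0 cC subnKC // ltnW.
- rewrite setIUr; split.
    apply: leq_trans (leq_card_setU _ _) _.
    by rewrite leq_add2l -cC subset_leq_card ?subsetIr.
  by rewrite (leq_trans _ (leq_addr _ _)) // subset_leq_card // subsetUl.
Qed.

Definition root4 (R : rcfType) (n : nat) : R := Num.sqrt (Num.sqrt n%:R).

Lemma root4_ge0 (R : rcfType) n : 0 <= root4 R n.
Proof. exact: sqrtr_ge0. Qed.

Lemma root4K (R : rcfType) n : root4 R n ^+ 4 = n%:R.
Proof. by rewrite -[4%N]/(2 * 2)%N exprM !sqr_sqrtr ?sqrtr_ge0. Qed.

(** Adding [U] itself to the family bounds the error on the size of the subset by
    the same quantity, and this error is then corrected.  With fewer than [5 n]
    sets, where [n = |U|], the fourth powers of the discrepancies are at most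
    [4 * (5 n) * n ^ 2 <= (3 n^(3/4)) ^ 4]; the correction doubles the error. *)
Lemma proportional_subset_exact (R : rcfType) (T : finType) (As : seq {set T})
    (U : {set T}) (n1 : nat) :
  (n1 <= #|U|)%N -> (size As < 5 * #|U|)%N ->
  exists B : {set T}, [/\ B \subset U, #|B| = n1 &
    forall A, A \in As ->
     `|#|A :&: B|%:R - n1%:R / #|U|%:R * #|A :&: U|%:R| <= 6 * root4 R #|U| ^+ 3].
Proof.
move=> n1U szAs.
have U0 : 0 < #|U|%:R :> R by rewrite ltr0n; lia.
pose rho : R := n1%:R / #|U|%:R.
have rho01 : 0 <= rho <= 1.
  by rewrite divr_ge0 ?ler0n //= ler_pdivrMr // mul1r ler_nat.
have [B BU HB] := proportional_subset (U :: As) U rho01.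
pose x := root4 R #|U|; have x0 : 0 <= x := root4_ge0 _ _.
have dev A : A \in U :: As -> `|#|A :&: B|%:R - rho * #|A :&: U|%:R| <= 3 * x ^+ 3.
  move=> /HB; move: (_ - _) => S le_S.
  rewrite -(@ler_pXn2r _ 4) ?nnegrE ?mulr_ge0 ?exprn_ge0 //.
  rewrite -normrX ger0_norm ?(exprn_even_ge0 _ (isT : ~~ odd 4)) //.
  apply: le_trans le_S _; rewrite exprMn exprAC root4K.
  have : ((size (U :: As))%:R <= 5 * #|U|%:R :> R) by rewrite -natrM ler_nat.
  move: (_%:R : R) => k; move: (#|U|%:R : R) U0 => u U0 ku.
  have u2 : 0 <= u ^+ 2 by apply: sqr_ge0.
  have : k * u ^+ 2 <= 5 * u ^+ 3 by rewrite [u ^+ 3]exprS mulrA ler_wpM2r.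
  have : 0 <= u ^+ 3 by rewrite exprn_ge0 // ltW.
  by rewrite -mulrA -natrX; lra.
have [B' [B'U cB' HB']] := resize_set BU n1U.
exists B'; split=> // A AAs; rewrite -/rho -/x.
have := dev U (mem_head _ _); rewrite setIid (setIidPr BU) /rho divfK ?gt_eqF // -/rho.
have := dev A (mem_behead (s := U :: As) AAs).
have [] := HB' A; rewrite -!(ler_nat R) !natrD => h1 h2 h3 h4.
have h5 : (n1 - #|B|)%:R <= `|#|B|%:R - n1%:R| :> R.
  have [le|/ltnW le] := leqP n1 #|B|; first by rewrite (eqP le) normr_ge0.
  by rewrite natrB // distrC ler_norm.
have h6 : (#|B| - n1)%:R <= `|#|B|%:R - n1%:R| :> R.
  have [/ltnW le|le] := ltnP n1 #|B|; last by rewrite (eqP le) normr_ge0.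
  by rewrite natrB // ler_norm.
move: h3; rewrite !ler_norml => /andP[h3 h3']; apply/andP; split; lra.
Qed.

(** The term in [n^(3/4)] is what makes the bound inductive: it is strictly
    concave, so that passing to a constant proportion of [n] relaxes it, relative
    to [n], by a multiple of the splitting error. *)
Definition threshold (R : rcfType) (alpha : R) (n : nat) : R :=
  (1 / 2 + alpha) * n%:R - 300 * root4 R n ^+ 3.

(** With [y = (n1 / n)^(1/4)], the gain is [300 * (y ^+ 3 - y ^+ 4) * n^(3/4)], and
    [y ^+ 3 - y ^+ 4 >= 1 / 50] since [y] stays away from [0] and [1]. *)
Lemma threshold_split (R : rcfType) (alpha : R) (n1 n : nat) :
  (n <= 4 * n1)%N -> (4 * n1 <= 3 * n)%N ->
  threshold alpha n1 <= n1%:R / n%:R * threshold alpha n - 6 * root4 R n ^+ 3.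
Proof.
move=> le1 le2.
have [n0|n_gt0] := posnP n.
  have n10 : n1 = 0%N by lia.
  by rewrite n10 n0 /threshold /root4 !sqrtr0 expr0n /= !mulr0 mul0r !subr0 mul0r.
have n0 : 0 < n%:R :> R by rewrite ltr0n.
have x0 : 0 < root4 R n by rewrite !sqrtr_gt0.
pose y := root4 R n1 / root4 R n.
have y0 : 0 <= y by rewrite divr_ge0 ?root4_ge0.
have root_n1 : root4 R n1 = y * root4 R n by rewrite divfK ?gt_eqF.
have y4 : y ^+ 4 = n1%:R / n%:R by rewrite expr_div_n !root4K.
rewrite /threshold root_n1 -y4.
have -> : n1%:R = y ^+ 4 * n%:R :> R by rewrite y4 divfK ?gt_eqF.
have y_lb : 7 / 10 <= y.
  have c0 : 0 <= 7 / 10 :> R by lra.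
  rewrite -(@ler_pXn2r _ 4) ?nnegrE // y4 ler_pdivlMr //.
  have : n%:R <= 4 * n1%:R :> R by rewrite -natrM ler_nat.
  by lra.
have y_ub : y <= 15 / 16.
  have c0 : 0 <= 15 / 16 :> R by lra.
  rewrite -(@ler_pXn2r _ 4) ?nnegrE // y4 ler_pdivrMr //.
  have : 4 * n1%:R <= 3 * n%:R :> R by rewrite -!natrM ler_nat.
  by lra.
have y34 : 1 / 50 <= y ^+ 3 - y ^+ 4.
  have : 343 / 1000 <= y ^+ 3.
    have -> : 343 / 1000 = (7 / 10) ^+ 3 :> R by lra.
    by rewrite ler_pXn2r ?nnegrE //; lra.
  by rewrite [y ^+ 4]exprSr; nra.
have x3 : 0 <= root4 R n ^+ 3 by rewrite exprn_ge0 ?root4_ge0.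
rewrite (exprMn 3 y).
move: (root4 R n ^+ 3) x3 => z z0.
rewrite -subr_ge0.
have -> : y ^+ 4 * ((1 / 2 + alpha) * n%:R - 300 * z) - 6 * z -
  ((1 / 2 + alpha) * (y ^+ 4 * n%:R) - 300 * (y ^+ 3 * z))
  = (300 * (y ^+ 3 - y ^+ 4) - 6) * z by ring.
by apply: mulr_ge0 => //; lra.
Qed.

(** * Recursive partition with inherited degree bounds *)

Section Partition.

(** [NV d v] and [NI d i] stand for the neighbourhoods, in the direction [d], of
    a vertex [v] and of the end of the path of index [i] from which it leaves in
    that direction; [g i] is the prescribed size of the block [i]. *)
Variables (R : rcfType) (T : finType) (I : eqType).
Variables (NV : bool -> T -> {set T}) (NI : bool -> I -> {set T}).
Variables (g : I -> nat) (q : nat) (alpha : R).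

Lemma threshold_bipartition (As : seq {set T}) (U : {set T}) (n1 n2 : nat) :
  #|U| = (n1 + n2)%N -> (n2 <= 3 * n1)%N -> (n1 <= 3 * n2)%N ->
  (size As < 5 * #|U|)%N ->
  (forall A, A \in As -> threshold alpha #|U| <= #|A :&: U|%:R) ->
  exists U1 U2 : {set T}, [/\ U1 :|: U2 = U, [disjoint U1 & U2],
    #|U1| = n1, #|U2| = n2 &
    forall A, A \in As -> threshold alpha n1 <= #|A :&: U1|%:R /\
                          threshold alpha n2 <= #|A :&: U2|%:R].
Proof.
move=> cardU le1 le2 szAs thrU.
have [|U1 [U1U card1 dev]] := @proportional_subset_exact R T As U n1 _ szAs.
  by rewrite cardU leq_addr.
have card2 : #|U :\: U1| = n2.
  by rewrite cardsD (setIidPr U1U) cardU card1 addKn.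
exists U1, (U :\: U1); split=> //.
- by rewrite -{1}(setIidPr U1U) setID.
- by rewrite disjoint_sym disjoints_subset setDE subsetIr.
move=> A AAs; have := dev A AAs; have := thrU A AAs.
have split_card : #|A :&: U|%:R = #|A :&: U1|%:R + #|A :&: (U :\: U1)|%:R :> R.
  by rewrite -natrD -(cardsID U1 (A :&: U)) -setIA (setIidPr U1U) setIDA.
have U0 : 0 < #|U|%:R :> R by rewrite ltr0n; lia.
have n2E : n2%:R / #|U|%:R = 1 - n1%:R / #|U|%:R :> R.
  apply: (mulIf (lt0r_neq0 U0)); rewrite mulrBl !divfK ?lt0r_neq0 // mul1r.
  by rewrite cardU natrD [_ + n2%:R]addrC addrK.
have thr1 : threshold alpha n1 <=
    n1%:R / #|U|%:R * threshold alpha #|U| - 6 * root4 R #|U| ^+ 3.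
  by apply: threshold_split; lia.
have thr2 : threshold alpha n2 <=
    n2%:R / #|U|%:R * threshold alpha #|U| - 6 * root4 R #|U| ^+ 3.
  by apply: threshold_split; lia.
have r1 : 0 <= n1%:R / #|U|%:R :> R by rewrite divr_ge0 ?ler0n.
have r2 : 0 <= n2%:R / #|U|%:R :> R by rewrite divr_ge0 ?ler0n.
move=> thrA; rewrite ler_norml => /andP[dev1 dev2].
have := ler_wpM2l r1 thrA; have := ler_wpM2l r2 thrA.
by rewrite n2E in thr2 *; split; lra.
Qed.

(** Only the neighbourhoods of the vertices of [U] and of the ends of the paths
    routed through [U] are controlled when [U] is halved; this keeps their number
    linear in [|U|] at every depth of the recursion, so that the final blocks may
    have bounded size. *)
Lemma balanced_partition (l : seq I) (U : {set T}) :
  (2 <= q)%N -> uniq l -> l != [::] ->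
  (forall i, i \in l -> (q <= g i <= q.+1)%N) -> #|U| = (\sum_(i <- l) g i)%N ->
  (forall b v, v \in U -> threshold alpha #|U| <= #|NV b v :&: U|%:R) ->
  (forall b i, i \in l -> threshold alpha #|U| <= #|NI b i :&: U|%:R) ->
  exists B : I -> {set T}, [/\ forall i, i \in l -> #|B i| = g i,
    forall i j, i \in l -> j \in l -> i != j -> [disjoint B i & B j],
    forall x, (x \in U) = has (fun i => x \in B i) l,
    forall b i v, i \in l -> v \in B i ->
      threshold alpha (g i) <= #|NV b v :&: B i|%:R &
    forall b i, i \in l -> threshold alpha (g i) <= #|NI b i :&: B i|%:R].
Proof.
move=> q2; have [k] := ubnP (size l).
elim: k l U => // k IH l U ltk ul l0 gq cardU thrV thrI.
have [l_le1|l_ge2] := leqP (size l) 1.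
  case: l {ltk gq} ul l0 l_le1 cardU thrI => [|i [|? ?]] // _ _ _.
  rewrite big_seq1 => cardU thrI.
  exists (fun=> U); split=> [j|j j'|x|b j v|b j]; rewrite ?inE /= ?orbF //.
  - by move/eqP->.
  - by move=> /eqP-> /eqP->; rewrite eqxx.
  - by move=> /eqP-> vU; rewrite -cardU thrV.
  - by move=> /eqP->; rewrite -cardU thrI ?mem_head.
set h := size l in ltk l_ge2.
pose l1 := take h./2 l; pose l2 := drop h./2 l.
have def_l : l = l1 ++ l2 by rewrite cat_take_drop.
have sz1 : size l1 = h./2 by rewrite size_takel // -/h; lia.
have sz2 : size l2 = (h - h./2)%N by rewrite size_drop.
have sum_bounds (s : seq I) : {subset s <= l} ->
    (q * size s <= \sum_(i <- s) g i <= q.+1 * size s)%N.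
  elim: s => [|i s IHs] sl; first by rewrite big_nil !muln0.
  have /gq gi : i \in l by apply/sl/mem_head.
  have := IHs (fun j js => sl j (mem_behead (s := i :: s) js)).
  by rewrite big_cons /= !mulnS; lia.
have sub1 : {subset l1 <= l} by move=> i; apply: mem_take.
have sub2 : {subset l2 <= l} by move=> i; apply: mem_drop.
have /andP[lb1 ub1] := sum_bounds l1 sub1.
have /andP[lb2 ub2] := sum_bounds l2 sub2.
have /andP[lb _] := sum_bounds l (fun i il => il).
rewrite sz1 in lb1 ub1; rewrite sz2 in lb2 ub2.
have cardU12 : #|U| = (\sum_(i <- l1) g i + \sum_(i <- l2) g i)%N.
  by rewrite cardU {1}def_l big_cat.
pose As := [seq NV true v | v <- enum U] ++ [seq NV false v | v <- enum U] ++
  [seq NI true i | i <- l] ++ [seq NI false i | i <- l].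
have AsP A : A \in As -> threshold alpha #|U| <= #|A :&: U|%:R.
  by rewrite !mem_cat => /or4P[] /mapP[v]; rewrite ?mem_enum => vU ->; auto.
have AsV b v : v \in U -> NV b v \in As.
  move=> vU; rewrite !mem_cat.
  by case: b; [apply/or4P/Or41 | apply/or4P/Or42]; rewrite map_f ?mem_enum.
have AsI b i : i \in l -> NI b i \in As.
  move=> il; rewrite !mem_cat.
  by case: b; [apply/or4P/Or43 | apply/or4P/Or44]; rewrite map_f.
have szAs : (size As < 5 * #|U|)%N.
  by rewrite !size_cat !size_map -cardE cardU -/h; rewrite -/h in lb; nia.
have [| |U1 [U2 [defU dis12 card1 card2 thr12]]] :=
  threshold_bipartition cardU12 _ _ szAs AsP.
- nia.
- nia.
have U1U : U1 \subset U by rewrite -defU subsetUl.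
have U2U : U2 \subset U by rewrite -defU subsetUr.
move: ul; rewrite {1}def_l cat_uniq => /and3P[ul1 /hasPn ndis ul2].
have [|||||||B1 [cB1 dB1 mB1 vB1 iB1]] := IH l1 U1.
- by rewrite sz1; lia.
- by [].
- by rewrite -size_eq0 sz1; lia.
- by move=> i /sub1/gq.
- by rewrite card1.
- by move=> b v vU; rewrite card1; apply: (thr12 _ (AsV b v (subsetP U1U _ vU))).1.
- by move=> b i il; rewrite card1; apply: (thr12 _ (AsI b i (sub1 _ il))).1.
have [|||||||B2 [cB2 dB2 mB2 vB2 iB2]] := IH l2 U2.
- by rewrite sz2; lia.
- by [].
- by rewrite -size_eq0 sz2; lia.
- by move=> i /sub2/gq.
- by rewrite card2.
- by move=> b v vU; rewrite card2; apply: (thr12 _ (AsV b v (subsetP U2U _ vU))).2.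
- by move=> b i il; rewrite card2; apply: (thr12 _ (AsI b i (sub2 _ il))).2.
have sB1 i : i \in l1 -> B1 i \subset U1.
  by move=> il; apply/subsetP => x xB; rewrite mB1; apply/hasP; exists i.
have sB2 i : i \in l2 -> B2 i \subset U2.
  by move=> il; apply/subsetP => x xB; rewrite mB2; apply/hasP; exists i.
have dB12 i j : i \in l1 -> j \in l2 -> [disjoint B1 i & B2 j].
  by move=> /sB1 s1 /sB2 s2; apply: disjointWl s1 (disjointWr s2 dis12).
have il2 i : i \in l2 -> (i \in l1) = false by move=> /ndis /negbTE.
exists (fun i => if i \in l1 then B1 i else B2 i); split.
- by move=> i; rewrite def_l mem_cat; case: ifP => [/cB1 //|_ /cB2].
- move=> i j; rewrite def_l !mem_cat.
  case: ifP => [i1 _|_ /= i2]; case: ifP => [j1 _|_ /= j2] //.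
  + exact: dB1.
  + by rewrite dB12.
  + by rewrite disjoint_sym dB12.
  + exact: dB2.
- move=> x; rewrite -defU inE mB1 mB2 def_l has_cat; congr (_ || _).
    by apply: eq_in_has => i ->.
  by apply: eq_in_has => i /il2 ->.
- move=> b i v; rewrite def_l mem_cat.
  by case: ifP => [i1 _ |_ /=]; [apply: vB1 | apply: vB2].
- move=> b i; rewrite def_l mem_cat.
  by case: ifP => [i1 _ |_ /=]; [apply: iB1 | apply: iB2].
Qed.
End Partition.

(** * From the partition to the subdivision *)

Lemma min_semidegree_le (D : digraph) (v : D) :
  (min_semidegree D <= outdeg v)%N /\ (min_semidegree D <= indeg v)%N.
Proof.
have bigmin_le (F : D -> nat) : (\big[minn/#|D|]_(u : D) F u <= F v)%N.
  have : v \in index_enum D by rewrite mem_index_enum.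
  elim: (index_enum D) => // u s IH; rewrite inE big_cons geq_min.
  by case/predU1P=> [->|/IH ->]; rewrite ?leqnn ?orbT.
by split; rewrite /min_semidegree geq_min bigmin_le ?orbT.
Qed.

Lemma card_no_isolated (H : digraph) :
  (forall v : H, ~~ isolated v) -> (#|H| <= 2 * #|arcs H|)%N.
Proof.
move=> no_iso.
have -> : #|H| = #|(fst @: arcs H) :|: (snd @: arcs H)|.
  rewrite -cardsT; apply: eq_card => v; rewrite !inE; apply/esym.
  have := no_iso v; rewrite negb_forall => /existsP[w].
  rewrite negb_and !negbK => /orP[vw|wv]; apply/orP; [left|right]; apply/imsetP.
    by exists (v, w); rewrite ?inE.
  by exists (w, v); rewrite ?inE.
apply: leq_trans (leq_card_setU _ _) _.
by rewrite mul2n -addnn leq_add ?leq_imset_card.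
Qed.

Lemma even_shares (I : eqType) (l : seq I) (N : nat) : uniq l -> l != [::] ->
  exists g : I -> nat, (\sum_(i <- l) g i)%N = N /\
    forall i, i \in l -> (N %/ size l <= g i <= (N %/ size l).+1)%N.
Proof.
move=> ul l0.
have h0 : (0 < size l)%N by rewrite lt0n size_eq0.
have lt_r := ltn_pmod N h0.
exists (fun i => N %/ size l + (index i l < N %% size l))%N; split; last first.
  by move=> i _; case: (_ < _)%N => /=; lia.
rewrite big_split /= big_const_seq count_predT iter_addn_0.
rewrite [RHS](divn_eq N (size l)); congr addn.
case: l ul l0 h0 lt_r => // x0 l' ul _ _ lt_r; set l := x0 :: l' in ul lt_r *.
rewrite (big_nth x0).
rewrite (eq_big_nat _ _ (F2 := fun i => (i < N %% size l)%N : nat)); last first.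
  by move=> i /andP[_ il]; rewrite index_uniq.
rewrite (big_cat_nat _ (n := N %% size l)) ?(ltnW lt_r) //=.
rewrite [X in (_ + X)%N]big1_seq ?addn0; last first.
  by move=> i; rewrite mem_index_iota => /andP[_ /andP[ri _]]; rewrite ltnNge ri.
rewrite (eq_big_nat _ _ (F2 := fun=> 1%N)) ?sum_nat_const_nat ?subn0 ?muln1 //.
by move=> i /andP[_ ->].
Qed.

(** The linear surplus [alpha * k] beats [300 * k^(3/4)] once
    [k > (300 / alpha) ^ 4]. *)
Lemma threshold_dominates (R : realType) (alpha : R) : 0 < alpha ->
  exists2 Q : nat, (2 <= Q)%N &
    forall k m : nat, (Q <= k)%N -> threshold alpha k <= m%:R -> (k < 2 * m)%N.
Proof.
move=> a0.
pose c : R := 300 / alpha.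
have c0 : 0 < c by rewrite divr_gt0.
pose Q := (Num.truncn (c ^+ 4)).+2.
have Qc : c ^+ 4 < Q%:R.
  apply: lt_trans (truncnS_gt _) _; by rewrite ltr_nat.
exists Q => // k m Qk; rewrite /threshold => le_m.
have x0 := root4_ge0 R k.
have cx : c < root4 R k.
  rewrite -(@ltr_pXn2r _ 4) ?nnegrE // ?(ltW c0) // root4K.
  by apply: lt_le_trans Qc _; rewrite ler_nat.
have xp : 0 < root4 R k by apply: lt_trans cx.
have : 300 * root4 R k ^+ 3 < alpha * k%:R.
  rewrite -[k%:R](root4K R) [_ ^+ 4]exprS [alpha * _]mulrA ltr_pM2r ?exprn_gt0 //.
  by move: cx; rewrite /c ltr_pdivrMr // mulrC.
rewrite -(ltr_nat R) natrM => lt_a; lra.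
Qed.

Lemma spanning_subdivision (H D : digraph) (b : H -> D) (U : {set D})
    (B : H * H -> {set D}) (q : nat) :
  injective b -> (forall x, (x \in U) = (x \notin codom b)) ->
  (forall x, (x \in U) = has (fun a => x \in B a) (enum (arcs H))) ->
  (forall a a', a \in arcs H -> a' \in arcs H -> a != a' -> [disjoint B a & B a']) ->
  (forall a, a \in arcs H -> (q <= #|B a| <= q.+1)%N) ->
  (forall a v, a \in arcs H -> v \in b a.1 |: B a ->
     (#|B a| < 2 * #|[set u in B a | arc v u]|)%N) ->
  (forall a v, a \in arcs H -> v \in b a.2 |: B a ->
     (#|B a| < 2 * #|[set u in B a | arc u v]|)%N) ->
  exists S : subdivision H D, spanning S /\ balanced S.
Proof.
move=> b_inj UE UB disB szB outB inB.
have BU a x : a \in arcs H -> x \in B a -> x \in U.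
  by move=> aH xB; rewrite UB; apply/hasP; exists a; rewrite ?mem_enum.
have bB a w : a \in arcs H -> b w \notin B a.
  move=> aH; apply/negP => /(BU _ _ aH); rewrite UE => /negP; apply.
  exact: codom_f.
have ex_path (a : H * H) : exists p : seq D, a \in arcs H ->
    [/\ path (@arc D) (b a.1) (rcons p (b a.2)), uniq (b a.1 :: rcons p (b a.2)),
      p =i B a & size p = #|B a|].
  case: (boolP (a \in arcs H)) => [aH|_]; last by exists [::].
  have [||||||p Hp] := @hamilton_path D (@arc D) (B a) (b a.1) (b a.2);
    last by exists p.
  - exact: arc_irr.
  - exact: bB.
  - exact: bB.
  - apply: contraTneq aH => /b_inj eq_a.
    by rewrite inE eq_a arc_irr.
  - by move=> v; apply: outB.
  - by move=> v; apply: inB.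
have [p Hp] := fin_all_exists ex_path.
have inArcs (u v : H) : arc u v -> (u, v) \in arcs H by rewrite inE.
pose inner u v := p (u, v).
have innerE u v : arc u v -> inner u v =i B (u, v) by move=> /inArcs/Hp[].
have Hpath u v : arc u v -> dipath (b u) (inner u v) (b v).
  by move=> /inArcs/Hp[pth un _ _]; apply/andP.
have Hbr u v w : arc u v -> b w \notin inner u v.
  by move=> uv; rewrite innerE // bB // inArcs.
have Hdis u v u' v' : arc u v -> arc u' v' -> (u, v) <> (u', v') ->
    forall x : D, x \in inner u v -> x \notin inner u' v'.
  move=> uv uv' /eqP neq x; rewrite !innerE // => xB.
  by rewrite (disjointFr (disB _ _ (inArcs _ _ uv) (inArcs _ _ uv') neq) xB).
exists (Subdivision b_inj Hpath Hbr Hdis); split.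
  move=> x /=; case: (boolP (x \in codom b)) => [/codomP[w ->]|xb].
    by left; exists w.
  right; move: xb; rewrite -UE UB => /hasP[[u v]]; rewrite mem_enum inE => uv xB.
  by exists u, v; rewrite innerE.
move=> u v u' v' uv uv'; rewrite /path_length /=.
have [_ _ _ ->] := Hp _ (inArcs _ _ uv); have [_ _ _ ->] := Hp _ (inArcs _ _ uv').
have := szB _ (inArcs _ _ uv); have := szB _ (inArcs _ _ uv'); lia.
Qed.

(** Half of [eps] pays for the neighbours lost to the branch vertices, which is the
    role of the term [2 / alpha] of the constant; the rest is the surplus [alpha]
    of the threshold.  The term [Q + 2] makes the blocks large enough for
    [threshold_dominates]. *)
Theorem theorem1p3 (R : realType) (eps : R) (eps_gt0 : 0 < eps) :
  exists C0 : R, 0 < C0 /\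
    forall (H D : digraph) (h n : nat),
      #|arcs H| = h -> (1 <= h)%N ->
      (forall v : H, ~~ isolated v) ->
      #|D| = n ->
      C0 * h%:R <= n%:R ->
      (1 / 2 + eps) * n%:R <= (min_semidegree D)%:R ->
      exists S : subdivision H D, spanning S /\ balanced S.
Proof.
pose alpha := eps / 2; have a0 : 0 < alpha by rewrite divr_gt0.
have [Q Q2 domQ] := threshold_dominates a0.
exists ((Q + 2)%:R + 2 / alpha); split.
  by rewrite addr_gt0 ?divr_gt0 // ltr0n addn2.
move=> H D h n cardH h1 no_iso cardD C0h minD.
have h0 : 0 <= h%:R :> R by rewrite ler0n.
have n0 : 0 <= n%:R :> R by rewrite ler0n.
have le_n : ((Q + 2) * h <= n)%N.
  rewrite -(ler_nat R) natrM; apply: le_trans C0h.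
  by rewrite mulrDl lerDl mulr_ge0 // divr_ge0 // ltW.
have le_2h : 2 * h%:R <= alpha * n%:R.
  have -> : 2 * h%:R = alpha * (2 / alpha * h%:R) by field; rewrite lt0r_neq0.
  rewrite ler_pM2l //; apply: le_trans C0h.
  by rewrite ler_wpM2r // lerDr.
have cardHv := card_no_isolated no_iso; rewrite cardH in cardHv.
have le_HD : (#|H| <= #|D|)%N by rewrite cardD; nia.
pose b (w : H) : D := enum_val (widen_ord le_HD (enum_rank w)).
have b_inj : injective b.
  by move=> w w' /enum_val_inj/(congr1 val) /= /val_inj/enum_rank_inj.
pose U := [set x : D | x \notin codom b].
have cardU : (#|U| + #|H| = n)%N.
  rewrite -(card_codom b_inj) -cardD -(cardC [in codom b]) addnC; congr addn.
  by apply: eq_card => x; rewrite !inE.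
pose l := enum (arcs H).
have szl : size l = h by rewrite -cardE.
have l0 : l != [::] by rewrite -size_eq0 szl -lt0n.
have [g [sum_g g_bounds]] := even_shares #|U| (enum_uniq _ : uniq l) l0.
rewrite szl in g_bounds; set q := (#|U| %/ h)%N in g_bounds.
have Qq : (Q <= q)%N by rewrite leq_divRL //; nia.
pose NV (dir : bool) (v : D) := if dir then [set w | arc v w] else [set w | arc w v].
pose NI (dir : bool) (a : H * H) := NV dir (b (if dir then a.1 else a.2)).
have thrU dir v : threshold alpha #|U| <= #|NV dir v :&: U|%:R.
  have degv : (min_semidegree D <= #|NV dir v|)%N.
    by have [] := min_semidegree_le v; case: dir.
  have degU : (#|NV dir v| <= #|NV dir v :&: U| + #|H|)%N.
    rewrite -(cardsID U (NV dir v)) leq_add2l -(card_codom b_inj).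
    by apply/subset_leq_card/subsetP => x; rewrite !inE negbK => /andP[].
  have : (min_semidegree D <= #|NV dir v :&: U| + 2 * h)%N by lia.
  rewrite -(ler_nat R) natrD natrM => le_deg.
  have : #|U|%:R <= n%:R :> R by rewrite ler_nat -cardU leq_addr.
  have : 0 <= root4 R #|U| ^+ 3 by rewrite exprn_ge0 ?root4_ge0.
  rewrite /threshold => r0 Un.
  have : (1 / 2 + alpha) * #|U|%:R <= (1 / 2 + alpha) * n%:R.
    by apply: ler_wpM2l => //; lra.
  move: minD; have -> : eps = 2 * alpha by rewrite /alpha; lra.
  lra.
have [|||||||B [cardB disB mU thrB thrI]] :=
  @balanced_partition R D _ NV NI g q alpha l U; rewrite ?enum_uniq //.
- exact: leq_trans Qq.
- by move=> dir i _; apply: thrU.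
have gt_deg dir a v : a \in arcs H -> v \in b (if dir then a.1 else a.2) |: B a ->
    (#|B a| < 2 * #|NV dir v :&: B a|)%N.
  move=> aH; rewrite -[a \in arcs H]mem_enum in aH; rewrite cardB // => vB.
  have Qg : (Q <= g a)%N by have /andP[qg _] := g_bounds a aH; apply: leq_trans qg.
  apply: domQ => //; move: vB; rewrite !inE => /predU1P[->|vB]; last exact: thrB.
  exact: thrI.
apply: (@spanning_subdivision H D b U B q) => //.
- by move=> x; rewrite inE.
- by move=> a a' aH aH'; apply: disB; rewrite mem_enum.
- by move=> a aH; rewrite cardB ?mem_enum // g_bounds ?mem_enum.
- move=> a v aH vB; have := gt_deg true a v aH vB.
  by congr (_ < 2 * _)%N; apply: eq_card => x; rewrite !inE andbC.
- move=> a v aH vB; have := gt_deg false a v aH vB.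
  by congr (_ < 2 * _)%N; apply: eq_card => x; rewrite !inE andbC.
Qed.
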